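(* Let $(X,\mathcal{B}_u)$ be the ball space of an ultrametric space $(X,u)$ whose value set is a countable narrow partially ordered set. Then $(X,\mathcal{B}_u)$ is chain union stable.
   Context: A partially ordered set is narrow if it contains no infinite set of pairwise incomparable elements. A ball space $(X,\mathcal{B})$ is a nonempty set $X$ together with a nonempty collection $\mathcal{B}$ of nonempty subsets of $X$ (called balls). A chain in $\mathcal{B}$ is a nonempty subset of $\mathcal{B}$ that is linearly ordered by inclusion. Define $\mathrm{cu}(\mathcal{B})=\{\bigcup\mathcal{C}\mid \emptyset\ne\mathcal{C}\subseteq\mathcal{B},\ \mathcal{C}\text{ is a chain}\}$. The ball space is chain union closed if $\mathrm{cu}(\mathcal{B})=\mathcal{B}$, and chain union stable if $(X,\mathrm{cu}(\mathcal{B}))$ is chain union closed. An ultrametric space $(X,u)$ with value set $\Gamma$ consists of a nonempty set $X$, a partially ordered set $\Gamma$ with smallest element $\bot$, and a function $u:X\times X\to\Gamma$ such that for all $x,y,z\in X$, $\gamma\in\Gamma$: (U1) $u(x,y)=\bot$ iff $x=y$; (U2) if $u(x,y)\le\gamma$ and $u(y,z)\le\gamma$ then $u(x,z)\le\gamma$; (U3) $u(x,y)=u(y,x)$. For $x,y\in X$, the (precise) ball is $B(x,y)=\{z\in X\mid u(x,z)\le u(x,y)\}$. The ball space of $(X,u)$ is $(X,\mathcal{B}_u)$ with $\mathcal{B}_u=\{B(x,y)\mid x,y\in X\}$. *)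

(* Defs.v *)
From mathcomp Require Import all_boot all_order.
From mathcomp Require Import boolp classical_sets functions cardinality.

Set Implicit Arguments.
Unset Strict Implicit.
Unset Printing Implicit Defensive.

Local Open Scope classical_set_scope.
Local Open Scope order_scope.

Definition narrow (disp : Order.disp_t) (Gamma : porderType disp) : Prop :=
  ~ exists A : set Gamma,
      infinite_set A /\ (forall a b, A a -> A b -> a <> b -> a >< b).

Record ballSpace (X : Type) := BallSpace {
  balls :> set (set X);
  ballSpace_carrier : [set: X] !=set0;
  ballSpace_nonempty : balls !=set0;
  ball_nonempty : forall B, balls B -> B !=set0
}.

Definition is_chain (X : Type) (BB CC : set (set X)) : Prop :=
  [/\ CC !=set0, CC `<=` BB & total_on CC subset].

Definition cu_balls (X : Type) (BB : set (set X)) : set (set X) :=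
  [set \bigcup_(B in CC) B | CC in is_chain BB].

Lemma cu_balls_nonempty (X : Type) (BB : ballSpace X) : cu_balls BB !=set0.
Proof.
have [B BB_B] := ballSpace_nonempty BB.
exists (\bigcup_(C in [set B]) C); exists [set B] => //; split.
- by exists B.
- by move=> C ->.
- by move=> C D -> ->; left.
Qed.

Lemma cu_ball_nonempty (X : Type) (BB : ballSpace X) (U : set X) :
  cu_balls BB U -> U !=set0.
Proof.
case=> CC [[B CC_B] CC_sub _] <-.
have [x Bx] := ball_nonempty (CC_sub _ CC_B).
by exists x, B.
Qed.

Definition cu (X : Type) (BB : ballSpace X) : ballSpace X :=
  BallSpace (ballSpace_carrier BB) (cu_balls_nonempty BB)
    (@cu_ball_nonempty X BB).

Definition chain_union_closed (X : Type) (BB : ballSpace X) : Prop :=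
  cu BB = BB :> set (set X).

Definition chain_union_stable (X : Type) (BB : ballSpace X) : Prop :=
  chain_union_closed (cu BB).

Record ultrametric (X : Type) (disp : Order.disp_t)
    (Gamma : bPOrderType disp) := Ultrametric {
  udist :> X -> X -> Gamma;
  ultra_carrier : [set: X] !=set0;
  ultra_eq0 : forall x y, udist x y = \bot <-> x = y;
  ultra_trans : forall (x y z : X) (gamma : Gamma),
    udist x y <= gamma -> udist y z <= gamma -> udist x z <= gamma;
  ultra_sym : forall x y, udist x y = udist y x
}.

Definition precise_ball (X : Type) (disp : Order.disp_t)
    (Gamma : bPOrderType disp) (u : ultrametric X Gamma) (x y : X) : set X :=
  [set z | u x z <= u x y].

Definition ultra_balls (X : Type) (disp : Order.disp_t)
    (Gamma : bPOrderType disp) (u : ultrametric X Gamma) : set (set X) :=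
  [set B | exists x y, B = precise_ball u x y].

Lemma ultra_balls_nonempty (X : Type) (disp : Order.disp_t)
    (Gamma : bPOrderType disp) (u : ultrametric X Gamma) :
  ultra_balls u !=set0.
Proof. by have [x _] := ultra_carrier u; exists (precise_ball u x x), x, x. Qed.

Lemma ultra_ball_nonempty (X : Type) (disp : Order.disp_t)
    (Gamma : bPOrderType disp) (u : ultrametric X Gamma) (B : set X) :
  ultra_balls u B -> B !=set0.
Proof. by case=> x [y ->]; exists y; rewrite /precise_ball /=. Qed.

Definition ultra_ballSpace (X : Type) (disp : Order.disp_t)
    (Gamma : bPOrderType disp) (u : ultrametric X Gamma) : ballSpace X :=
  BallSpace (ultra_carrier u) (ultra_balls_nonempty u)
    (@ultra_ball_nonempty X disp Gamma u).

(* Main.v *)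
Require Import Defs.
From mathcomp Require Import all_boot all_order.
From mathcomp Require Import boolp classical_sets functions cardinality.

(** The balls of an ultrametric space behave like compact sets: a ball [B(a,b)]
    lies in any ball containing both [a] and [b].  Hence, for countable value
    set, a nonempty [U] is the union of a chain of balls as soon as any three
    points of [U] lie in a common ball inside [U]: fix [x] in [U], enumerate the
    countably many values [u x z] with [z] in [U], and build an increasing
    sequence of balls absorbing one [z] for each value.  The three-point
    property is inherited by unions of chains. *)

Import Order.TTheory.

Local Open Scope classical_set_scope.
Local Open Scope order_scope.

(** Triples rather than pairs: to enlarge a ball one needs two points that generate it and a third
    to absorb. *)
Definition covers_triples {X : Type} (FF : set (set X)) (U : set X) : Prop :=
  forall x y z, U x -> U y -> U z ->
    exists B, [/\ FF B, B `<=` U & [/\ B x, B y & B z]].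

(** Among three members of a chain, one contains the other two. *)
Lemma chain_covers_triples {X : Type} (CC : set (set X)) :
  total_on CC subset -> covers_triples CC (\bigcup_(C in CC) C).
Proof.
move=> tot x y z [A CCA Ax] [B CCB By] [C CCC Cz].
have [D [CCD Dx Dy]] : exists D, [/\ CC D, D x & D y].
  case: (tot A B CCA CCB) => sub; first by exists B; split=> //; exact: sub.
  by exists A; split=> //; exact: sub.
case: (tot C D CCC CCD) => sub.
  exists D; split=> //; first exact: bigcup_sup.
  by split=> //; exact: sub.
exists C; split=> //; first exact: bigcup_sup.
by split=> //; exact: sub.
Qed.

Lemma cu_balls_covers_triples {X : Type} (BB : set (set X)) (U : set X) :
  cu_balls BB U -> covers_triples BB U.
Proof.
case=> CC [_ subBB tot] <- x y z Ux Uy Uz.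
have [B [CCB BU Bxyz]] := chain_covers_triples _ tot x y z Ux Uy Uz.
by exists B; split=> //; exact: subBB.
Qed.

Lemma cu_cu_balls_covers_triples {X : Type} (BB : set (set X)) (U : set X) :
  cu_balls (cu_balls BB) U -> covers_triples BB U.
Proof.
move=> /cu_balls_covers_triples cuU x y z Ux Uy Uz.
have [V [cuV VU [Vx Vy Vz]]] := cuU x y z Ux Uy Uz.
have [B [BBB BV Bxyz]] := cu_balls_covers_triples _ _ cuV x y z Vx Vy Vz.
by exists B; split=> //; exact: subset_trans VU.
Qed.

Lemma sub_cu_balls {X : Type} (BB : set (set X)) : BB `<=` cu_balls BB.
Proof.
move=> B BBB; exists [set B]; last exact: bigcup_set1.
split; first by exists B.
- by move=> C ->.
- by move=> C D -> ->; left.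
Qed.

Section UltrametricBalls.
Variables (X : Type) (disp : Order.disp_t) (Gamma : bPOrderType disp).
Variable u : ultrametric X Gamma.

Lemma precise_ball_center a b : precise_ball u a b a.
Proof.
by rewrite /precise_ball /= (_ : u a a = \bot) ?le0x //; apply/ultra_eq0.
Qed.

Lemma precise_ball_radius a b : precise_ball u a b b.
Proof. exact: lexx. Qed.

(** Both points are within [u a b] of [a], so [u x y <= u a b]; a further application of
    [ultra_trans], through [x], bounds [u a z]. *)
Lemma precise_ball_sub {a b x y} :
  precise_ball u a b x -> precise_ball u a b y ->
  precise_ball u x y `<=` precise_ball u a b.
Proof.
rewrite /precise_ball /= => ax ay z xz.
apply: (ultra_trans ax); apply: (le_trans xz).
by apply: (@ultra_trans _ _ _ u x a y) => //; rewrite ultra_sym.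
Qed.

Lemma covers_triples_cu_balls (U : set X) :
  countable [set: Gamma] -> U !=set0 ->
  covers_triples (ultra_balls u) U -> cu_balls (ultra_balls u) U.
Proof.
move=> /countable_injP [code code_inj] [x Ux] triU.
(* [w n] represents all points of [U] whose distance from [x] has code [n]; it defaults to [x] if
   there are none. *)
have /choice [w w_spec] : forall n, exists w,
    U w /\ forall z, U z -> code (u x z) = n -> u x z = u x w.
  move=> n; have [[w [Uw wn]]|no] := pselect (exists w, U w /\ code (u x w) = n).
    exists w; split=> // z _ zn; apply: code_inj; rewrite ?inE //.
    by rewrite zn wn.
  by exists x; split=> // z Uz zn; case: no; exists z.
pose ball p := precise_ball u p.1 p.2.
have /choice [next next_spec] : forall pz : (X * X) * X, exists q,
    ball pz.1 `<=` U -> U pz.2 ->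
    [/\ ball q `<=` U, ball pz.1 `<=` ball q, ball q x & ball q pz.2].
  move=> [[a b] z] /=.
  have [[abU Uz]|no] := pselect (ball (a, b) `<=` U /\ U z); last first.
    by exists (a, b) => abU Uz; case: no.
  have Ua := abU _ (precise_ball_center a b).
  have Ub := abU _ (precise_ball_radius a b).
  (* One ball must contain the four points [a], [b], [z], [x]: a ball through [a], [b], [z] is
     enlarged to one that also contains [x]. *)
  have [_ [[c [d ->]] cdU [cda cdb cdz]]] := triU a b z Ua Ub Uz.
  have Uc := cdU _ (precise_ball_center c d).
  have Ud := cdU _ (precise_ball_radius c d).
  have [_ [[e [f ->]] efU [efc efd efx]]] := triU c d x Uc Ud Ux.
  have cd_ef := precise_ball_sub efc efd.
  exists (e, f) => _ _; split=> //; last exact: cd_ef.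
  exact: subset_trans (precise_ball_sub cda cdb) cd_ef.
(* The sequence starts from the one-point ball at [x], and stage [m.+1] absorbs [w m]. *)
pose s := fix s n := if n is m.+1 then next (s m, w m) else (x, x).
have sU n : ball (s n) `<=` U.
  elim: n => [z|n IHn].
    rewrite /ball /precise_ball /= (_ : u x x = \bot); last exact/ultra_eq0.
    by rewrite lex0 => /eqP /ultra_eq0 <-.
  by have [] := next_spec (s n, w n) IHn (w_spec n).1.
have s_next n := next_spec (s n, w n) (sU n) (w_spec n).1.
have s_mono m n : (m <= n)%N -> ball (s m) `<=` ball (s n).
  elim: n => [|n IHn]; first by rewrite leqn0 => /eqP ->.
  rewrite leq_eqVlt => /orP [/eqP -> //|/IHn sub].
  by have [_ step _ _] := s_next n; exact: subset_trans step.
exists (range (ball \o s)).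
  split; first by exists (ball (s 0%N)), 0%N.
    by move=> _ [n _ <-]; exists (s n).1, (s n).2.
  move=> _ _ [m _ <-] [n _ <-] /=.
  by case/orP: (leq_total m n) => le_mn; [left|right]; exact: s_mono.
apply/seteqP; split=> [z [_ [n _ <-]]|z Uz]; first exact: sU.
pose n := code (u x z).
(* This ball contains [x] and [w n], hence all of [precise_ball u x (w n)], where [z] lies because
   [u x z = u x (w n)]. *)
exists (ball (s n.+1)); first by exists n.+1.
have [_ _ sx sw] := s_next n.
apply: (precise_ball_sub sx sw).
by rewrite /precise_ball /= ((w_spec n).2 z Uz erefl).
Qed.

End UltrametricBalls.

Theorem theorem2p4 (X : Type) (disp : Order.disp_t) (Gamma : bPOrderType disp)
    (u : ultrametric X Gamma) :
  countable [set: Gamma] ->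
  narrow Gamma ->
  chain_union_stable (ultra_ballSpace u).
Proof.
move=> countG _; apply/seteqP; split=> [U cuU|]; last exact: sub_cu_balls.
apply: covers_triples_cu_balls => //; last exact: cu_cu_balls_covers_triples.
exact: (ball_nonempty (b := cu (cu (ultra_ballSpace u)))).
Qed.
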